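(* Let $P=\{P_n(x)\}_{n=0}^{\infty}$ be a sequence of orthogonal polynomials on an interval $\mathcal{I}=(l,r)\subseteq\mathbb{R}$ of the real line. Let $M(x)=\frac{ax+b}{cx+d}$ with $a,b,c,d\in\mathbb{C}$, $ad-bc\ne0$, let $W(x)=-\frac{dx-b}{cx-a}$ be its inverse, and let $Q=\{Q_n(x)\}_{n=0}^{\infty}$ be the sequence of Möbius-transformed orthogonal polynomials $Q_n(x)=(cx+d)^nP_n(M(x))$. Then, for $n\ge1$, the zeros of any two consecutive polynomials $Q_n(x)$ and $Q_{n+1}(x)$ of the sequence interlace on the new curve of orthogonality $\Gamma=\{W(x): l<x<r\}$.
   Context: A sequence of orthogonal polynomials on $(l,r)$ is a sequence of polynomials $P_n$ with $\deg P_n=n$ such that $\int_l^rP_m(x)P_n(x)w(x)\,dx=K_m\delta_{m,n}$, $K_m>0$, for some continuous non-negative weight function $w$ on $(l,r)$ (the interval may be finite, semi-infinite or infinite). $M$ and $W$ are mutually inverse bijections of the extended complex plane $\mathbb{C}_\infty=\mathbb{C}\cup\{\infty\}$, with $W(a/c)=\infty$. The ordering of points on $\Gamma$ is understood in $\mathbb{C}_\infty$: it runs along the curve from $W(l)$ to $W(r)$, passing through $\infty$ when $a/c\in(l,r)$. Interlacing means that, in this order, there is exactly one zero of $Q_n$ strictly between any two consecutive zeros of $Q_{n+1}$.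
   Formalization: Zeros are counted in the extended complex plane: ∞ counts as a zero of Q_n when deg Q_n < n, i.e. when P_n(a/c)=0; with finite zeros only the claim fails (Hermite, M(x)=1/x: Q_1=2, Q_2=4-2x^2). *)

(* Defs.v *)
From HB Require Import structures.
From mathcomp Require Import all_boot all_order all_algebra.
From mathcomp Require Import all_classical all_reals all_analysis.
From mathcomp Require Import complex.

Set Implicit Arguments.
Unset Strict Implicit.
Unset Printing Implicit Defensive.

Import Order.TTheory GRing.Theory Num.Theory.
Import numFieldNormedType.Exports.

Local Open Scope classical_set_scope.
Local Open Scope ring_scope.
Local Open Scope complex_scope.

(* The endpoints are extended reals: the interval may be unbounded. *)
Definition oitv (R : realType) (l r : \bar R) : set R :=
  [set x | (l < x%:E)%E /\ (x%:E < r)%E].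

(* The integrals are extended-real Lebesgue integrals. The case m = n forces
   each P_n ^ 2 w, hence each P_m P_n w, to be integrable, so integrability
   is not a separate clause. *)
Definition orthogonal_polynomials (R : realType) (l r : \bar R)
    (P : nat -> {poly R}) : Prop :=
  (forall n, size (P n) = n.+1) /\
  exists w : R -> R, exists K : nat -> R,
    [/\ {within oitv l r, continuous w},
        (forall x, oitv l r x -> 0 <= w x),
        (forall m, 0 < K m)
      & forall m n,
          (\int[@lebesgue_measure R]_(x in oitv l r)
              ((P m).[x] * (P n).[x] * w x)%:E)%E =
          (if m == n then K m else 0)%:E].

(* The extended complex plane; None is the point at infinity. *)
Definition extC (R : realType) : Type := option R[i].

Definition mobius (R : realType) (a b c d : R[i]) (z : extC R) : extC R :=
  match z with
  | Some x =>
      if c * x + d == 0 then None else Some ((a * x + b) / (c * x + d))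
  | None => if c == 0 then None else Some (a / c)
  end.

(* W(x) = - (d x - b) / (c x - a). *)
Definition mobius_inv (R : realType) (a b c d : R[i]) : extC R -> extC R :=
  mobius (- d) b c (- a).

(* Q_n (x) = (c x + d) ^ n P_n (M x) wherever M x is finite, i.e. for all but
   at most one x; this determines the polynomial Q_n. *)
Definition mobius_transformed (R : realType) (a b c d : R[i])
    (P : nat -> {poly R}) (Q : nat -> {poly R[i]}) : Prop :=
  forall (n : nat) (x y : R[i]), mobius a b c d (Some x) = Some y ->
    (Q n).[x] = (c * x + d) ^+ n * (map_poly (real_complex R) (P n)).[y].

Definition curve (R : realType) (a b c d : R[i]) (l r : \bar R) :
    set (extC R) :=
  [set mobius_inv a b c d (Some x%:C) | x in oitv l r].

(* z1 is met strictly before z2 on the way from W(l) to W(r); W is injective,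
   so the parameters x1 and x2 are unique. *)
Definition curve_lt (R : realType) (a b c d : R[i]) (l r : \bar R)
    (z1 z2 : extC R) : Prop :=
  exists x1 x2 : R,
    [/\ oitv l r x1, oitv l r x2, x1 < x2,
        mobius_inv a b c d (Some x1%:C) = z1
      & mobius_inv a b c d (Some x2%:C) = z2].

(* Zeros in the extended plane of q, seen as a polynomial of nominal degree n:
   infinity is a zero when deg q < n. For Q_n this happens exactly when
   c != 0 and P_n (M oo) = P_n (a / c) = 0, the zero a / c of P_n being sent by
   W to infinity. *)
Definition ext_zeros (R : realType) (n : nat) (q : {poly R[i]}) :
    set (extC R) :=
  [set z | match z with
           | Some x => root q x : Prop
           | None => (size q <= n)%N : Prop
           end].

Definition between (T : Type) (lt : T -> T -> Prop) (z1 z2 : T) : set T :=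
  [set z | lt z1 z /\ lt z z2].

Definition consecutive (T : Type) (lt : T -> T -> Prop) (Z : set T)
    (z1 z2 : T) : Prop :=
  [/\ Z z1, Z z2, lt z1 z2 & Z `&` between lt z1 z2 = set0].

(* Z plays the role of the zeros of Q_n, Z' that of the zeros of Q_(n+1);
   being interlaced on G includes lying on G. *)
Definition interlace_on (T : Type) (G : set T) (lt : T -> T -> Prop)
    (Z Z' : set T) : Prop :=
  [/\ Z `<=` G, Z' `<=` G
    & forall z1 z2, consecutive lt Z' z1 z2 ->
        exists! z, (Z `&` between lt z1 z2) z].

(* Main.v *)
Require Import Defs.
From HB Require Import structures.
From mathcomp Require Import all_boot all_order all_algebra.
From mathcomp Require Import all_classical all_reals all_analysis.
From mathcomp Require Import complex.
From mathcomp Require Import measurable_realfun polyrcf ring lra.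

Import Order.TTheory GRing.Theory Num.Theory.
Import numFieldNormedType.Exports.
Local Open Scope classical_set_scope.
Local Open Scope ring_scope.

(* Let [L p] be the integral of [p w]. If [f] is a nonzero combination of
   [P_n] and [P_(n+1)] with a double real root [x], then [f = (x - X)^2 g] with
   [deg g < n], so that [0 = L (f g) = L ((x - X)^2 g^2) > 0], a contradiction.
   Hence the Wronskian of [P_n] and [P_(n+1)] has no real zero, and Rolle's
   theorem applied to [P_n / P_(n+1)] and to [P_(n+1) / P_n] gives the
   uniqueness and the existence of a zero of [P_n] between two consecutive zeros
   of [P_(n+1)]. The same trick, with a linear or an irreducible quadratic
   factor in place of the square, shows that all zeros of [P_n] are real and lie
   in [(l, r)]. Finally, the zeros of [Q_n] in the extended plane, of nominal
   degree [n], are exactly the images under [W] of the zeros of [P_n]. *)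

(** * Expansion in a graded basis of polynomials *)

(** Cancelling the leading term of [p] by a multiple of [P m], with [m = deg p], lowers the size.
    The bound [m < N] keeps [P N] out of the expansion, as [orth_small] requires. *)
Lemma graded_basis_ind (F : fieldType) (P : nat -> {poly F})
    (T : {poly F} -> Prop) (N : nat) :
  (forall n, size (P n) = n.+1) -> T 0 ->
  (forall k m q, (m < N)%N -> T q -> T (q + k *: P m)) ->
  forall p : {poly F}, (size p <= N)%N -> T p.
Proof.
move=> sizeP T0 TD p; have [n] := ubnP (size p).
elim: n p => // n IH p; rewrite ltnS => pn pN.
have [->//|p0] := eqVneq p 0.
set m := (size p).-1; pose k := lead_coef p / lead_coef (P m).
have sm : size p = m.+1 by rewrite /m prednK // size_poly_gt0.
have lP : lead_coef (P m) != 0 by rewrite lead_coef_eq0 -size_poly_eq0 sizeP.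
have sq : (size (p - k *: P m)%R <= m)%N.
  apply/leq_sizeP => j; rewrite leq_eqVlt => /orP[/eqP <-|mj].
    move: lP; rewrite coefB coefZ /k !lead_coefE sm sizeP /= => lP.
    by rewrite divfK ?subrr.
  by rewrite coefB coefZ !nth_default ?mulr0 ?subrr// ?sizeP ?sm.
rewrite -(subrK (k *: P m) p); apply: TD; first by rewrite -sm.
have qp : (size (p - k *: P m)%R < size p)%N by rewrite sm ltnS.
by apply: IH; [exact: leq_trans qp pn | exact: leq_trans (ltnW qp) pN].
Qed.

Lemma measurable_oitv (R : realType) (l r : \bar R) : measurable (oitv l r).
Proof.
apply: is_interval_measurable => x y [lx _] [_ yr] z /andP[xz zy]; split.
  by rewrite (lt_le_trans lx) ?lee_fin.
by rewrite (le_lt_trans _ yr) ?lee_fin.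
Qed.

(** * The integral against the weight as a positive functional *)

Section moment.
Context (R : realType).
Let T := measurableTypeR R.
Context (D : set T) (P : nat -> {poly R}) (w : T -> R) (K : nat -> R).
Hypothesis mD : measurable D.
Hypothesis sizeP : forall n, size (P n) = n.+1.
Hypothesis mw : measurable_fun D w.
Hypothesis w0 : forall x, D x -> 0 <= w x.
Hypothesis K0 : forall m, 0 < K m.
Hypothesis KP : forall m n,
  (\int[@lebesgue_measure R]_(x in D) ((P m).[x] * (P n).[x] * w x)%:E)%E =
  (if m == n then K m else 0)%:E.

Let mu := @lebesgue_measure R.

Lemma measurable_poly_weight (p : {poly R}) :
  measurable_fun D (EFin \o (fun x : T => p.[x] * w x)).
Proof.
apply/measurable_EFinP; apply: measurable_funM => //; exact: measurable_poly.
Qed.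

(** The finite value [K n] makes [(P n)^2 w] integrable. As [P 0] is a nonzero constant, [w] is
    integrable too, and [|y| <= y^2 + 1] then bounds [P n w]. The [P n] span all polynomials. *)
Lemma integrable_poly_weight (p : {poly R}) :
  mu.-integrable D (fun x => (p.[x] * w x)%:E).
Proof.
have PP n : mu.-integrable D (fun x => ((P n ^+ 2).[x] * w x)%:E).
  apply/integrableP; split; first exact: measurable_poly_weight.
  rewrite (_ : (\int[mu]_(x in D) _)%E = (K n)%:E) ?ltry//.
  have := KP n n; rewrite eqxx => <-; apply: eq_integral => x /set_mem Dx.
  by rewrite gee0_abs ?hornerE// lee_fin mulr_ge0 ?w0 ?horner_exp ?sqr_ge0.
have p0 : (P 0)`_0 != 0.
  have : lead_coef (P 0%N) != 0 by rewrite lead_coef_eq0 -size_poly_eq0 sizeP.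
  by rewrite lead_coefE sizeP.
have w1 : mu.-integrable D (fun x => (w x)%:E).
  have := integrableZl mD ((P 0)`_0 ^- 2) (PP 0%N).
  apply: eq_integrable => // x _; rewrite -EFinM; congr EFin.
  rewrite (size1_polyC (_ : size (P 0%N) <= 1)%N) ?sizeP// coefC /= !hornerE.
  by rewrite /=; field.
have P1 n : mu.-integrable D (fun x => ((P n).[x] * w x)%:E).
  apply: (le_integrable mD _ _ (integrableD mD (PP n) w1)).
    exact: measurable_poly_weight.
  move=> x Dx /=; have ww := w0 x Dx.
  rewrite lee_fin horner_exp [leRHS]ger0_norm; last first.
    by apply: addr_ge0 => //; apply: mulr_ge0 => //; apply: sqr_ge0.
  rewrite normrM (ger0_norm ww) -[X in _ <= _ + X]mul1r -mulrDl ler_wpM2r //.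
  set y := _.[x]; rewrite -[y ^+ 2]real_normK ?num_real//.
  by have := sqr_ge0 (`|y| - 1); have := normr_ge0 y; nra.
apply: (graded_basis_ind _ P (fun p : {poly R} =>
    mu.-integrable D (fun x => (p.[x] * w x)%:E)) (size p)) => //.
  have := integrable0 mu D; apply: eq_integrable => // x _.
  by rewrite horner0 mul0r.
move=> k m q _ iq; have := integrableD mD iq (integrableZl mD k (P1 m)).
apply: eq_integrable => // x _ /=.
by rewrite -EFinD hornerD hornerZ mulrDl mulrA.
Qed.

Definition moment (p : {poly R}) : R := \int[mu]_(x in D) (p.[x] * w x).

Lemma momentD p q : moment (p + q) = moment p + moment q.
Proof.
rewrite /moment -RintegralD//; try exact: integrable_poly_weight.
by congr Rintegral; apply: funext => x; rewrite hornerD mulrDl.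
Qed.

Lemma momentZ k p : moment (k *: p) = k * moment p.
Proof.
rewrite /moment -RintegralZl//; try exact: integrable_poly_weight.
by congr Rintegral; apply: funext => x; rewrite hornerZ mulrA.
Qed.

Lemma moment_orth m n : (m < n)%N -> moment (P n * P m) = 0.
Proof.
move=> mn; rewrite /moment /Rintegral.
under eq_integral do rewrite hornerM.
by rewrite KP gtn_eqF.
Qed.

(** Otherwise [p w = 0] almost everywhere on [D]. The roots of [p] are finitely many, hence
    negligible, so [w = 0] almost everywhere on [D], and [K 0 = 0]. *)
Lemma moment_gt0 p : p != 0 -> (forall x, D x -> 0 <= p.[x]) -> 0 < moment p.
Proof.
move=> pn0 p0.
have pw x : D x -> 0 <= p.[x] * w x by move=> Dx; rewrite mulr_ge0 ?p0 ?w0.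
rewrite lt_neqAle Rintegral_ge0// andbT eq_sym; apply/eqP => L0.
have : (\int[mu]_(x in D) `|(p.[x] * w x)%:E| = 0)%E.
  rewrite -[RHS]/(0%:E) -L0 /moment /Rintegral fineK.
    by apply: eq_integral => x /set_mem Dx; rewrite gee0_abs ?lee_fin ?pw.
  exact/integrable_fin_num/integrable_poly_weight.
move/(ae_eq_integral_abs mu mD (measurable_poly_weight p)) => pw0.
have pae : {ae mu, forall x, ~~ root p x}.
  have fin : finite_set [set` rootsR p] by exact: finite_seq.
  exists [set` rootsR p]; split.
  - exact: countable_measurable (finite_set_countable fin).
  - exact: countable_lebesgue_measure0 (finite_set_countable fin).
  move=> x /= /negP; rewrite negbK => px.
  by rewrite -(roots_on_rootsR pn0) px in_itv.
have : (\int[mu]_(x in D) ((P 0).[x] * (P 0).[x] * w x)%:E = 0)%E.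
  rewrite (ae_eq_integral (cst 0%E)) ?integral0//.
    have := measurable_poly_weight (P 0%N * P 0%N).
    by apply: eq_measurable_fun => x _ /=; rewrite hornerM.
  apply: filterS2 pw0 pae => x pw0 px Dx.
  have /eqP := pw0 Dx; rewrite eqe mulf_eq0 => /orP[/eqP p0x|/eqP ->].
    by move: px; rewrite /root p0x eqxx.
  by rewrite mulr0.
by rewrite KP eqxx => /eqP; rewrite eqe gt_eqF.
Qed.
End moment.

(** * Rolle's theorem for a quotient of polynomials *)

Lemma rolle_ratio (R : realType) (p q : {poly R}) (a b : R) :
  a < b -> root p a -> root p b ->
  (forall x, a <= x <= b -> ~~ root q x) ->
  exists2 c, a < c < b & p^`().[c] * q.[c] - p.[c] * q^`().[c] = 0.
Proof.
move=> ab /rootP pa /rootP pb q0.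
pose f : R -> R := (horner p * (fun y => (q.[y])^-1))%R.
pose df : R -> R := fun x =>
  p.[x] *: (- q.[x] ^- 2 *: q^`().[x]) + q.[x]^-1 *: p^`().[x].
have dfE x : a <= x <= b -> is_derive x (1 : R) f (df x).
  by move=> /q0 qx; apply: is_deriveM; apply: is_deriveV.
have fc : {within `[a, b], continuous f}.
  apply: derivable_within_continuous => x; rewrite in_itv /= => /dfE H.
  exact: ex_derive.
have [|c cab] := @MVT R f df a b ab _ fc.
  by move=> x; rewrite in_itv /= => /andP[ax xb]; apply: dfE; rewrite !ltW.
move: cab; rewrite in_itv /= => cab.
have qc : q.[c] != 0 by apply: q0; case/andP: cab => ac cb; rewrite !ltW.
rewrite /f /= !fctE pa pb !mul0r subrr => /esym/eqP.
rewrite mulf_eq0 subr_eq0 (gt_eqF ab) orbF => /eqP df0.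
(* The Wronskian is [(p / q)' q^2]. *)
exists c => //; transitivity (df c * q.[c] ^+ 2); last by rewrite df0 mul0r.
by rewrite /df /GRing.scale /=; field.
Qed.

(** * Zeros of polynomials orthogonal for a positive functional *)

Section positive_functional.
Context (R : realType) (l r : \bar R) (P : nat -> {poly R}) (L : {poly R} -> R).
Hypothesis sizeP : forall n, size (P n) = n.+1.
Hypothesis LD : forall p q : {poly R}, L (p + q) = L p + L q.
Hypothesis LZ : forall k (p : {poly R}), L (k *: p) = k * L p.
Hypothesis L_orth : forall m n, (m < n)%N -> L (P n * P m) = 0.
Hypothesis L_gt0 :
  forall p : {poly R}, p != 0 ->
    (forall x, oitv l r x -> 0 <= p.[x]) -> 0 < L p.

Lemma orth_small n (g : {poly R}) : (size g <= n)%N -> L (P n * g) = 0.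
Proof.
apply: (graded_basis_ind _ P (fun g => L (P n * g) = 0) n) => //.
  by rewrite mulr0 -(scale0r (0 : {poly R})) LZ mul0r.
by move=> k m q mn q0; rewrite mulrDr -scalerAr LD LZ q0 L_orth // mulr0 addr0.
Qed.

(** If [f] were nonzero, [f g = q g^2] would be a nonzero polynomial, non-negative on the interval,
    so [L (f g) > 0]. Each fact below on the place or multiplicity of zeros is a choice of [q]. *)
Lemma orth_factor (f q g : {poly R}) :
  L (f * g) = 0 -> f = q * g -> (forall x, oitv l r x -> 0 <= q.[x]) -> f = 0.
Proof.
move=> fg0 fE q0; apply/eqP; apply: contraT => f0.
have g0 : g != 0 by apply: contraNneq f0 => g0; rewrite fE g0 mulr0.
suff : 0 < L (f * g) by rewrite fg0 ltxx.
apply: L_gt0 => [|x xD]; first by rewrite mulf_neq0.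
by rewrite fE -mulrA hornerM -expr2 horner_exp mulr_ge0 ?q0 ?sqr_ge0.
Qed.

Lemma comb_neq0 n (u v : R) : (u != 0) || (v != 0) ->
  u *: P n + v *: P n.+1 != 0.
Proof.
have lP m : (P m)`_m != 0.
  have : lead_coef (P m) != 0 by rewrite lead_coef_eq0 -size_poly_eq0 sizeP.
  by rewrite lead_coefE sizeP.
have [->|v0 _] := eqVneq v 0.
  by rewrite orbF scale0r addr0 scaler_eq0 -size_poly_eq0 sizeP orbF.
apply/eqP => /(congr1 (fun p : {poly R} => p`_n.+1)).
rewrite coef0 coefD !coefZ (nth_default _ (_ : (size (P n) <= _)%N)) ?sizeP//.
by rewrite mulr0 add0r => /eqP; rewrite mulf_eq0 (negbTE v0) (negbTE (lP _)).
Qed.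

Lemma comb_simple_root n (u v x : R) : (u != 0) || (v != 0) ->
  root (u *: P n + v *: P n.+1) x -> ~~ root (u *: P n + v *: P n.+1)^`() x.
Proof.
move=> uv; have := comb_neq0 n _ _ uv; set f := _ + _ => f0.
(* Since [f' = h' (X - x) + h], a root of [f'] at [x] is a root of [h], and [X - x] divides [f]
   twice. *)
move=> /factor_theorem [h fh]; apply/negP; rewrite fh derivM derivXsubC mulr1.
rewrite /root hornerD hornerM hornerXsubC subrr mulr0 add0r.
move=> /factor_theorem [g hg]; case/negP: f0; apply/eqP.
apply: (orth_factor f (('X - x%:P) ^+ 2) g); last first.
- by move=> y _; rewrite horner_exp sqr_ge0.
- by rewrite fh hg expr2; ring.
have [->|g0] := eqVneq g 0.
  by rewrite mulr0 -(scale0r (0 : {poly R})) LZ mul0r.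
(* Two linear factors leave a polynomial of size at most [n.+2], so [g] is orthogonal to both [P n]
   and [P n.+1]. *)
have gn : (size g <= n)%N.
  have : (size f <= n.+2)%N.
    rewrite (leq_trans (size_polyD _ _))// geq_max.
    by rewrite !(leq_trans (size_scale_leq _ _)) ?sizeP.
  rewrite fh hg !size_Mmonic ?monicXsubC ?mulf_neq0 ?polyXsubC_eq0 //.
  by rewrite !size_XsubC !addn2.
by rewrite mulrDl -!scalerAl LD !LZ !orth_small ?mulr0 ?addr0 // (leq_trans gn).
Qed.

(** A zero of the Wronskian makes a 2 by 2 system singular: some nonzero [(u, v)] kills both the
    value and the derivative of [u P_n + v P_(n+1)] at [x], against [comb_simple_root]. *)
Lemma wronskian_neq0 n x :
  (P n)^`().[x] * (P n.+1).[x] - (P n).[x] * (P n.+1)^`().[x] != 0.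
Proof.
have combE u v :
    (u *: P n + v *: P n.+1).[x] = u * (P n).[x] + v * (P n.+1).[x].
  by rewrite hornerD !hornerZ.
have dcombE u v : (u *: P n + v *: P n.+1)^`().[x] =
    u * (P n)^`().[x] + v * (P n.+1)^`().[x].
  by rewrite derivD !derivZ hornerD !hornerZ.
apply/eqP => W0.
suff [u [v [uv /rootP ux /rootP /negPn/negP[]]]] : exists u v,
    [/\ (u != 0) || (v != 0), (u *: P n + v *: P n.+1).[x] = 0
      & (u *: P n + v *: P n.+1)^`().[x] = 0].
  exact: comb_simple_root.
(* The kernel vector is read off the row of values, or off the row of derivatives if the values
   vanish; if both rows vanish, any nonzero vector serves. *)
have [pq|] := boolP (((P n.+1).[x] != 0) || (- (P n).[x] != 0)).
  exists (P n.+1).[x], (- (P n).[x]); split => //; rewrite ?combE ?dcombE.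
    by ring.
  by rewrite -W0; ring.
rewrite oppr_eq0 negb_or !negbK => /andP[/eqP q0 /eqP p0].
have [pq|] := boolP (((P n.+1)^`().[x] != 0) || (- (P n)^`().[x] != 0)).
  exists (P n.+1)^`().[x], (- (P n)^`().[x]).
  split => //; rewrite ?combE ?dcombE.
    by rewrite p0 q0 !mulr0 addr0.
  by ring.
rewrite oppr_eq0 negb_or !negbK => /andP[/eqP dq0 /eqP dp0].
exists 1, 0; split; first by rewrite oner_eq0.
  by rewrite combE p0 q0 !mulr0 addr0.
by rewrite dcombE dp0 dq0 !mulr0 addr0.
Qed.

(** If [x] is outside the interval, [X - x] has constant sign on it, while its cofactor [g] in [P n]
    has degree below [n] and is orthogonal to [P n]. *)
Lemma root_in_oitv n x : root (P n) x -> oitv l r x.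
Proof.
move=> /factor_theorem [g Pg].
have Pn0 : P n != 0 by rewrite -size_poly_eq0 sizeP.
have g0 : g != 0 by apply: contraNneq Pn0 => g0; rewrite Pg g0 mul0r.
have sg : (size g <= n)%N.
  have := sizeP n.
  by rewrite Pg size_Mmonic ?monicXsubC// size_XsubC addn2 => -[->].
have Lg : L (P n * g) = 0 by exact: orth_small.
split; rewrite ltNge; apply/negP => xlr; case/eqP: Pn0.
  apply: (orth_factor _ ('X - x%:P) g) => //; first by rewrite mulrC.
  move=> y [ly _]; rewrite hornerXsubC subr_ge0 -lee_fin.
  by rewrite (le_trans xlr) ?ltW.
(* For [r <= x] the sign is reversed in both factors. *)
apply: (orth_factor _ (x%:P - 'X) (- g)).
- by rewrite mulrN -scaleN1r LZ Lg mulr0.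
- by rewrite mulrN -mulNr opprB mulrC.
move=> y [_ yr]; rewrite !hornerE subr_ge0 -lee_fin.
by rewrite (le_trans _ xlr) ?ltW.
Qed.

(** A zero [u + iv] with [v != 0] makes the real quadratic [(X - u)^2 + v^2] a divisor of [P n]. It
    is non-negative and the quotient has degree below [n], so [orth_factor] applies. *)
Lemma complex_root_real n (z : R[i]) :
  root (map_poly (real_complex R) (P n)) z ->
  exists2 x, root (P n) x & z = (x%:C)%C.
Proof.
case: z => u v; have [->|v0] := eqVneq v 0.
  by rewrite complexr0 fmorph_root => Pu; exists u.
move=> Pz; exfalso.
pose q : {poly R} := ('X - u%:P) ^+ 2 + (v ^+ 2)%:P.
have qE x : q.[x] = (x - u) ^+ 2 + v ^+ 2.
  by rewrite hornerD horner_exp hornerXsubC hornerC.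
have sq : size q = 3%N.
  have sX : size (('X - u%:P) ^+ 2) = 3%N by rewrite size_exp_XsubC.
  by rewrite size_polyDl sX // (leq_ltn_trans (size_polyC_leq1 _)).
have qz : root (map_poly (real_complex R) q) (u +i* v)%C.
  rewrite /root rmorphD rmorphXn rmorphB /= map_polyX !map_polyC /=.
  rewrite hornerD horner_exp hornerXsubC hornerC /=.
  by apply/eqP; simpc; congr Complex; ring.
have q0 : q != 0 by rewrite -size_poly_eq0 sq.
have rz : root (map_poly (real_complex R) (P n %% q)) (u +i* v)%C.
  have := Pz; rewrite {1}(divp_eq (P n) q) rmorphD rmorphM /=.
  by rewrite /root hornerD hornerM (rootP qz) mulr0 add0r.
(* The remainder [s0 + s1 X] vanishes at [u + iv]: the imaginary part [s1 v] gives [s1 = 0], then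
   the real part gives [s0 = 0]. *)
have r0 : P n %% q = 0.
  have srem : (size (P n %% q)%R <= 2)%N by rewrite -ltnS -sq ltn_modp.
  move: rz srem; move: (P n %% q) => s rz srem; move: rz.
  have -> : s = (s`_0)%:P + s`_1 *: 'X :> {poly R}.
    apply/polyP => -[|[|i]]; rewrite coefD coefC coefZ coefX;
      rewrite ?mulr0 ?mulr1 ?addr0 ?add0r//=.
    by rewrite nth_default // (leq_trans srem).
  rewrite /root rmorphD /= map_polyC map_polyZ map_polyX /= !hornerE.
  simpc; rewrite eq_complex /= => /andP[/eqP e1 /eqP e2].
  have s1 : s`_1 = 0.
    by apply/eqP; move/eqP: e2; rewrite mulf_eq0 (negbTE v0) orbF.
  by move: e1; rewrite s1 mul0r addr0 => ->; rewrite scale0r addr0.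
have Pq : P n = q * (P n %/ q) by rewrite {1}(divp_eq (P n) q) r0 addr0 mulrC.
have : P n = 0.
  apply: (orth_factor _ q (P n %/ q)) => //.
    by apply: orth_small; rewrite size_divp // sizeP sq subSS leq_subr.
  by move=> x _; rewrite qE addr_ge0 ?sqr_ge0.
by move/eqP; rewrite -size_poly_eq0 sizeP.
Qed.

Lemma consecutive_roots_interlace n x1 x2 : x1 < x2 ->
  root (P n.+1) x1 -> root (P n.+1) x2 ->
  (forall x, x1 < x < x2 -> ~~ root (P n.+1) x) ->
  exists! y, x1 < y < x2 /\ root (P n) y.
Proof.
move=> x12 qx1 qx2 q0.
have common x : root (P n.+1) x -> ~~ root (P n) x.
  move=> /rootP qx; apply/negP => /rootP px.
  by have := wronskian_neq0 n x; rewrite px qx mulr0 mul0r subr0 eqxx.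
have [[y [yx py]]|no] := pselect (exists y, x1 < y < x2 /\ root (P n) y).
  exists y; split => // y' [y'x py'].
  (* Uniqueness: between two zeros of [P n] in the gap, where [P n.+1] does not vanish, Rolle for
     [P_n / P_(n+1)] would give a zero of the Wronskian. *)
  have aux a b : x1 < a -> b < x2 -> root (P n) a -> root (P n) b -> ~ a < b.
    move=> xa bx pa pb ab.
    have [x axb|c _] := rolle_ratio R (P n) (P n.+1) a b ab pa pb.
      apply: q0; move/andP: axb => [ax xb].
      by rewrite (lt_le_trans xa ax) (le_lt_trans xb bx).
    by apply/eqP; exact: wronskian_neq0.
  move/andP: yx => [xy yx]; move/andP: y'x => [xy' y'x].
  by case: (ltgtP y y') => // [/aux[]|/aux[]].
(* Existence: with no zero of [P n] in the gap, and none at its ends by [common], Rolle applies to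
   [P_(n+1) / P_n] on [[x1, x2]]. *)
have [x|c _] := rolle_ratio R (P n.+1) (P n) x1 x2 x12 qx1 qx2.
  move=> /andP[]; rewrite le_eqVlt => /orP[/eqP <- _|x1x]; first exact: common.
  rewrite le_eqVlt => /orP[/eqP ->|xx2]; first exact: common.
  by apply/negP => px; apply: no; exists x; rewrite x1x xx2.
move=> W0; exfalso; have /eqP := wronskian_neq0 n c; apply.
by apply/eqP; rewrite -oppr_eq0 -W0; apply/eqP; ring.
Qed.
End positive_functional.

(** * Top coefficients relative to nominal degrees *)

(** Sizes are only bounded, because the top coefficients [a ^+ k] and [c ^+ (n - k)] met later may
    be zero. *)
Lemma coef_mul_top (F : nzRingType) (p q : {poly F}) i j :
  (size p <= i.+1)%N -> (size q <= j.+1)%N -> (p * q)`_(i + j) = p`_i * q`_j.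
Proof.
move=> pi qj; rewrite coefM.
rewrite (bigD1 (inord i : 'I_(i + j).+1)) //= inordK ?ltnS ?leq_addr //.
rewrite addKn big1 ?addr0 // => k ki.
have [lt|lt|] := ltngtP k i.
- by rewrite [q`__]nth_default ?mulr0 // (leq_trans qj) // ltn_subRL ltn_add2r.
- by rewrite [p`__]nth_default ?mul0r // (leq_trans pi).
- by move=> kE; case/eqP: ki; apply: val_inj; rewrite /= inordK ?ltnS ?leq_addr.
Qed.

Lemma linear_exp_coef (F : comNzRingType) (a b : F) n :
  (size ((a *: 'X + b%:P) ^+ n) <= n.+1)%N /\
  ((a *: 'X + b%:P) ^+ n)`_n = a ^+ n.
Proof.
have s2 : (size (a *: 'X + b%:P)%R <= 2)%N.
  rewrite (leq_trans (size_polyD _ _))// geq_max.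
  rewrite (leq_trans (size_scale_leq _ _)) ?size_polyX //=.
  by rewrite (leq_trans (size_polyC_leq1 _)).
elim: n => [|n [sn cn]]; first by rewrite !expr0 size_poly1 coef1.
split.
  rewrite exprS (leq_trans (size_polyMleq _ _)) // -subn1 leq_subLR add1n.
  by rewrite (leq_trans (leq_add s2 sn)).
rewrite exprS -add1n coef_mul_top // cn coefD coefZ coefX coefC /= addr0 mulr1.
by rewrite exprS.
Qed.

Lemma poly_everywhere0 (F : numFieldType) (p : {poly F}) :
  (forall x, p.[x] = 0) -> p = 0.
Proof.
move=> p0; apply: (@roots_geq_poly_eq0 _ _ [seq k%:R | k <- iota 0 (size p)]).
- by apply/allP => x _; apply/rootP.
- by rewrite map_inj_uniq ?iota_uniq // => i j /eqP; rewrite eqr_nat => /eqP.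
- by rewrite size_map size_iota.
Qed.

(** * Möbius transformation of polynomials and of their zeros *)

Section mobius.
Context (R : realType) (a b c d : R[i]).
Hypothesis det0 : a * d - b * c != 0.

(** The binary form of degree [n] attached to [p], taken at [(a X + b, c X + d)]; it also has a
    value at the pole of [M]. *)
Definition homogenize n (p : {poly R[i]}) : {poly R[i]} :=
  \sum_(k < n.+1) p`_k *: ((a *: 'X + b%:P) ^+ k * (c *: 'X + d%:P) ^+ (n - k)).

Lemma homogenizeE n (p : {poly R[i]}) x :
  (size p <= n.+1)%N -> c * x + d != 0 ->
  (homogenize n p).[x] = (c * x + d) ^+ n * p.[(a * x + b) / (c * x + d)].
Proof.
move=> sp x0; rewrite (horner_coef_wide _ sp) mulr_sumr horner_sum.
apply: eq_bigr => k _; rewrite hornerZ hornerM !horner_exp.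
rewrite !hornerD !hornerZ !hornerX !hornerC.
have kn : (k <= n)%N by rewrite -ltnS.
have -> : (c * x + d) ^+ n = (c * x + d) ^+ (n - k) * (c * x + d) ^+ k.
  by rewrite -exprD subnK.
rewrite expr_div_n; move: (_ ^+ (n - k)) => y.
by field; rewrite expf_neq0.
Qed.

Lemma homogenize_pole n (p : {poly R[i]}) x : c * x + d = 0 ->
  (homogenize n p).[x] = p`_n * (a * x + b) ^+ n.
Proof.
move=> x0; rewrite horner_sum big_ord_recr /= big1 ?add0r.
  rewrite subnn expr0 mulr1 hornerZ horner_exp.
  by rewrite hornerD hornerZ hornerX hornerC.
move=> k _; rewrite hornerZ hornerM !horner_exp !hornerD !hornerZ !hornerX.
by rewrite !hornerC x0 expr0n subn_eq0 leqNgt ltn_ord /= mulr0 mulr0.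
Qed.

(** For [c != 0] and [size p <= n.+1] the sum is [c^n p(a / c)]; it vanishes exactly when infinity
    is an extended zero. *)
Lemma coef_homogenize n (p : {poly R[i]}) :
  (homogenize n p)`_n = \sum_(k < n.+1) p`_k * (a ^+ k * c ^+ (n - k)).
Proof.
rewrite coef_sum; apply: eq_bigr => k _; rewrite coefZ.
have kn : (k <= n)%N by rewrite -ltnS.
have [sa ca] := linear_exp_coef _ a b k.
have [sc cc] := linear_exp_coef _ c d (n - k).
by have := coef_mul_top _ _ _ _ _ sa sc; rewrite subnKC // => ->; rewrite ca cc.
Qed.

Lemma size_homogenize n (p : {poly R[i]}) : (size (homogenize n p) <= n.+1)%N.
Proof.
apply: (leq_trans (size_sum _ _ _)); apply/bigmax_leqP => k _.
apply: (leq_trans (size_scale_leq _ _)).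
have kn : (k <= n)%N by rewrite -ltnS.
have [sa _] := linear_exp_coef _ a b k.
have [sc _] := linear_exp_coef _ c d (n - k).
apply: (leq_trans (size_polyMleq _ _)).
by rewrite -subn1 leq_subLR (leq_trans (leq_add sa sc)) // addnS addSn subnKC.
Qed.

(** The denominator of [W] at [M x] is [-(a d - b c) / (c x + d)], hence nonzero. *)
Lemma mobiusK x y : mobius a b c d (Some x) = Some y ->
  mobius_inv a b c d (Some y) = Some x.
Proof.
rewrite /mobius_inv /mobius; case: eqP => // /eqP x0 [<-].
have e : c * ((a * x + b) / (c * x + d)) - a = - (a * d - b * c) / (c * x + d).
  by field.
rewrite e mulf_eq0 oppr_eq0 (negbTE det0) invr_eq0 (negbTE x0) /=.
by congr Some; field; rewrite x0 det0.
Qed.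

Lemma mobius_invK x y : mobius_inv a b c d (Some y) = Some x ->
  mobius a b c d (Some x) = Some y.
Proof.
rewrite /mobius_inv /mobius; case: eqP => // /eqP y0 [<-].
have e : c * ((- d * y + b) / (c * y - a)) + d =
    - (a * d - b * c) / (c * y - a).
  by field.
rewrite e mulf_eq0 oppr_eq0 (negbTE det0) invr_eq0 (negbTE y0) /=.
by congr Some; field; rewrite y0 det0.
Qed.

Lemma mobius_inv_pole y : mobius_inv a b c d (Some y) = None ->
  c != 0 /\ y = a / c.
Proof.
rewrite /mobius_inv /mobius; case: eqP => // y0 _.
have c0 : c != 0.
  apply: contraNneq det0 => c0; move: y0; rewrite c0 mul0r add0r.
  by move=> /eqP; rewrite oppr_eq0 => /eqP ->; rewrite mul0r mulr0 subr0.
split=> //; apply: (mulfI c0); rewrite mulrCA divff // mulr1.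
by apply/eqP; rewrite -subr_eq0 y0.
Qed.

(** Finite images are undone by [M], and only [a / c] can go to infinity. *)
Lemma mobius_inv_inj x y :
  mobius_inv a b c d (Some x) = mobius_inv a b c d (Some y) ->
  x = y.
Proof.
case E : (mobius_inv a b c d (Some y)) => [z|] E'.
  by have := mobius_invK _ _ E; rewrite (mobius_invK _ _ E') => -[].
by have [_ ->] := mobius_inv_pole _ E; have [_ ->] := mobius_inv_pole _ E'.
Qed.

(** The two sides are known to agree only off the pole of [M]. Multiplied by [c X + d], a nonzero
    polynomial since the determinant is nonzero, their difference vanishes everywhere. *)
Lemma mobius_transformedE (P : nat -> {poly R}) (Q : nat -> {poly R[i]}) n :
  (size (P n) <= n.+1)%N -> mobius_transformed a b c d P Q ->
  Q n = homogenize n (map_poly (real_complex R) (P n)).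
Proof.
move=> sP PQ; apply/eqP; rewrite -subr_eq0; set T := homogenize _ _.
have : (Q n - T) * (c *: 'X + d%:P) = 0.
  apply: poly_everywhere0 => x.
  rewrite hornerM hornerD hornerN hornerD hornerZ hornerX hornerC.
  have [->|x0] := eqVneq (c * x + d) 0; first by rewrite mulr0.
  rewrite (PQ n x ((a * x + b) / (c * x + d))).
    by rewrite /T homogenizeE ?size_map_poly // subrr mul0r.
  by rewrite /mobius (negbTE x0).
move/eqP; rewrite mulf_eq0 => /orP[//|/eqP cd0]; move: det0.
have c0 : c = 0.
  have : (c *: 'X + d%:P)`_1 = 0 by rewrite cd0 coef0.
  by rewrite coefD coefZ coefX coefC /= mulr1 addr0.
have d0 : d = 0.
  have : (c *: 'X + d%:P)`_0 = 0 by rewrite cd0 coef0.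
  by rewrite coefD coefZ coefX coefC /= mulr0 add0r.
by rewrite c0 d0 !mulr0 subrr eqxx.
Qed.

(** Off its pole, [M] matches finite zeros of [Q n] with zeros of [P n]. The pole itself is no zero
    of [Q n], and a zero [a / c] of [P n] becomes the zero at infinity. *)
Lemma ext_zerosE (P : nat -> {poly R}) (Q : nat -> {poly R[i]}) n :
  size (P n) = n.+1 ->
  (forall z, root (map_poly (real_complex R) (P n)) z ->
    exists2 x, root (P n) x & z = (x%:C)%C) ->
  mobius_transformed a b c d P Q ->
  ext_zeros n (Q n) =
    [set mobius_inv a b c d (Some (x%:C)%C) | x in [set x | root (P n) x]].
Proof.
move=> sP realP PQ.
have sPC : (size (map_poly (real_complex R) (P n)) <= n.+1)%N.
  by rewrite size_map_poly sP.
have lP : (map_poly (real_complex R) (P n))`_n != 0.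
  rewrite coef_map fmorph_eq0.
  have : lead_coef (P n) != 0 by rewrite lead_coef_eq0 -size_poly_eq0 sP.
  by rewrite lead_coefE sP.
have QE := mobius_transformedE P Q n _ PQ; rewrite {}QE ?sP //.
set p := map_poly _ _ in realP sPC lP *.
have rootE x : c * x + d != 0 -> root (homogenize n p) x =
    root p ((a * x + b) / (c * x + d)).
  move=> x0.
  by rewrite /root homogenizeE // mulf_eq0 expf_eq0 (negbTE x0) andbF.
(* The degree drops when the top coefficient vanishes. This coefficient is [p_n a^n], nonzero, if
   [c = 0], and [c^n p(a / c)] otherwise. *)
have infE : (size (homogenize n p) <= n)%N <->
    c != 0 /\ root p (a / c).
  have -> : (size (homogenize n p) <= n)%N =
      ((homogenize n p)`_n == 0).
    apply/idP/eqP => [sn|h0]; first by rewrite nth_default.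
    apply/leq_sizeP => j; rewrite leq_eqVlt => /orP[/eqP <- //|nj].
    by rewrite nth_default // (leq_trans (size_homogenize _ _)).
  rewrite coef_homogenize.
  have [c0|c0] := eqVneq c 0.
    rewrite big_ord_recr /= big1 ?add0r => [|k _]; last first.
      by rewrite c0 expr0n subn_eq0 leqNgt ltn_ord /= !mulr0.
    have a0 : a != 0.
      by apply: contraNneq det0 => ->; rewrite c0 mul0r mulr0 subrr.
    rewrite subnn mulr1 mulf_eq0 (negbTE lP) expf_eq0 (negbTE a0) andbF.
    by split=> // -[].
  suff -> : \sum_(k < n.+1) p`_k * (a ^+ k * c ^+ (n - k)) = c ^+ n * p.[a / c].
    rewrite mulf_eq0 expf_eq0 (negbTE c0) andbF.
    by split=> [|[_]]; rewrite /root.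
  rewrite (horner_coef_wide _ sPC) mulr_sumr; apply: eq_bigr => k _.
  have -> : c ^+ n = c ^+ (n - k) * c ^+ k by rewrite -exprD subnK // -ltnS.
  by rewrite expr_div_n; move: (c ^+ (n - k)) => y; field; rewrite expf_neq0.
apply/seteqP; split => [[x|] /=|_ [t Pt <-]].
(* A zero of [Q n] at the pole would give [a x + b = c x + d = 0], hence a zero determinant. *)
- have [x0|x0] := eqVneq (c * x + d) 0.
    rewrite /root homogenize_pole // mulf_eq0 (negbTE lP) expf_eq0 /=.
    move=> /andP[_ /eqP y0].
    exfalso; move/negP: det0; apply; apply/eqP.
    have [-> ->] : d = - (c * x) /\ b = - (a * x).
      by split; apply/eqP; rewrite -addr_eq0 addrC ?x0 ?y0.
    by ring.
  rewrite rootE // => /realP[t Pt tE]; exists t => //; rewrite -tE.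
  by apply: mobiusK => //; rewrite /mobius (negbTE x0).
- move/infE => [c0 /realP[t Pt tE]]; exists t => //; rewrite -tE.
  by rewrite /mobius_inv /mobius mulrC divfK // subrr eqxx.
- have pt : root p (t%:C)%C by rewrite fmorph_root; exact: Pt.
  case E: (mobius_inv a b c d (Some (t%:C)%C)) => [x|].
    have := mobius_invK _ _ E; rewrite /mobius.
    by case: eqP => // /eqP x0 [tE] /=; rewrite rootE // tE.
  have [c0 tE] := mobius_inv_pole _ E.
  by apply/infE; rewrite -tE.
Qed.
End mobius.

(** * Transport of the interlacing from the interval to the curve *)

Theorem theorem7 (R : realType) (l r : \bar R) (P : nat -> {poly R})
    (a b c d : R[i]) (Q : nat -> {poly R[i]}) :
  (l < r)%E ->
  orthogonal_polynomials l r P ->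
  a * d - b * c != 0 ->
  mobius_transformed a b c d P Q ->
  forall n : nat, (1 <= n)%N ->
    interlace_on (curve a b c d l r) (curve_lt a b c d l r)
      (ext_zeros n (Q n)) (ext_zeros n.+1 (Q n.+1)).
Proof.
move=> _ [sizeP [w [K [cw w0 K0 KP]]]] det0 PQ n _.
have mD := measurable_oitv R l r.
have mw : measurable_fun (oitv l r) w.
  exact: subspace_continuous_measurable_fun.
pose L := moment R (oitv l r) w.
have LD : forall p q : {poly R}, L (p + q) = L p + L q.
  exact: (momentD _ _ P _ K).
have LZ : forall k (p : {poly R}), L (k *: p) = k * L p.
  exact: (momentZ _ _ P _ K).
have L_orth : forall m n, (m < n)%N -> L (P n * P m) = 0.
  exact: (moment_orth _ _ P _ K).
have L_gt0 : forall p : {poly R}, p != 0 ->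
    (forall x, oitv l r x -> 0 <= p.[x]) -> 0 < L p.
  exact: (moment_gt0 _ _ P _ K).
have inD := root_in_oitv _ _ _ _ _ sizeP LD LZ L_orth L_gt0.
have zE m : ext_zeros m (Q m) =
    [set mobius_inv a b c d (Some (x%:C)%C) | x in [set x | root (P m) x]].
  apply: ext_zerosE => //.
  exact: (complex_root_real _ l r P L).
have W_inj (x y : R) : mobius_inv a b c d (Some (x%:C)%C) =
    mobius_inv a b c d (Some (y%:C)%C) -> x = y.
  by move=> /(mobius_inv_inj _ _ _ _ _ det0) /complexI.
(* By injectivity of [W], the order along the curve, infinity included, is the order of the real
   parameters. *)
have ltE (x y : R) : curve_lt a b c d l r (mobius_inv a b c d (Some (x%:C)%C))
    (mobius_inv a b c d (Some (y%:C)%C)) <->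
    [/\ oitv l r x, oitv l r y & x < y].
  split=> [[x' [y' [x'D y'D x'y' /W_inj <- /W_inj <-]]]|[xD yD xy]] //.
  by exists x, y.
rewrite !zE; split.
- by move=> _ [x /= px <-]; exists x => //; exact: inD px.
- by move=> _ [x /= px <-]; exists x => //; exact: inD px.
move=> _ _ [[x1 /= px1 <-] [x2 /= px2 <-] /ltE[x1D x2D x12] noz].
have [|y [[/andP[x1y yx2] py] yuniq]] := consecutive_roots_interlace
    _ _ _ _ _ sizeP LD LZ L_orth L_gt0 n x1 x2 x12 px1 px2.
  (* A zero of [P n.+1] between [x1] and [x2] would be sent by [W] between two consecutive zeros of
     [Q n.+1]. *)
  move=> x /andP[x1x xx2]; apply/negP => px; have xD := inD _ _ px.
  suff : set0 (mobius_inv a b c d (Some (x%:C)%C)) by [].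
  by rewrite -noz; split; [exists x | split; apply/ltE].
have yD := inD _ _ py.
exists (mobius_inv a b c d (Some (y%:C)%C)); split.
  by split; [exists y | split; apply/ltE].
move=> _ [[y' /= py' <-] [/ltE[_ _ x1y'] /ltE[_ _ y'x2]]].
by rewrite (yuniq y') // x1y' y'x2.
Qed.
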